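(* For every function $f\colon\{0,1\}^n\to\mathbb{R}$, the best symmetric approximation of $f$ with respect to $w$ is given by $$A(f)=\sum_{j=1}^{n+1}c_j\,\mathrm{os}_j,$$ where $c_j=\overline{f}(n-j+1)-\overline{f}(n-j)$ for every $j\in[n+1]$.
   Context: Let $n\geqslant 1$, $[m]=\{1,\ldots,m\}$, and $|\mathbf{x}|=\sum_{i=1}^n x_i$ for $\mathbf{x}\in\{0,1\}^n$. Let $F(\{0,1\}^n)$ be the real vector space of functions $\{0,1\}^n\to\mathbb{R}$ and $F_S(\{0,1\}^n)$ its subspace of symmetric functions (invariant under all permutations of the variables). Let $w\colon\{0,1\}^n\to\left]0,\infty\right[$ be a weight function, normalized so that $\sum_{\mathbf{x}\in\{0,1\}^n}w(\mathbf{x})=1$. The best symmetric approximation of $f$ with respect to $w$, denoted $A(f)$, is the unique $g\in F_S(\{0,1\}^n)$ minimizing $\|f-g\|^2=\sum_{\mathbf{x}\in\{0,1\}^n}w(\mathbf{x})(f(\mathbf{x})-g(\mathbf{x}))^2$ among all symmetric functions; equivalently, the orthogonal projection of $f$ onto $F_S(\{0,1\}^n)$ for the inner product $\langle f,g\rangle=\sum_{\mathbf{x}}w(\mathbf{x})f(\mathbf{x})g(\mathbf{x})$. For $s\in\{0,1,\ldots,n\}$ define $$\overline{f}(s)=\frac{\sum_{|\mathbf{x}|=s}w(\mathbf{x})f(\mathbf{x})}{\sum_{|\mathbf{x}|=s}w(\mathbf{x})},$$ and set $\overline{f}(-1)=0$. For $k\in[n]$, $\mathrm{os}_k\colon\{0,1\}^n\to\{0,1\}$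 is the $k$th order statistic function: $\mathrm{os}_k(\mathbf{x})=x_{(k)}$, the $k$th smallest coordinate of $\mathbf{x}$; equivalently $\mathrm{os}_k(\mathbf{x})=1$ if $|\mathbf{x}|\geqslant n-k+1$ and $0$ otherwise. Also $\mathrm{os}_{n+1}\equiv 1$. *)

(* Defs.v *)
From HB Require Import structures.
From mathcomp Require Import all_boot all_order all_algebra all_fingroup.
From mathcomp Require Import reals.

Set Implicit Arguments.
Unset Strict Implicit.
Unset Printing Implicit Defensive.

Import Order.TTheory GRing.Theory Num.Theory.
Local Open Scope ring_scope.

Definition cube (n : nat) : finType := {ffun 'I_n -> bool}.

(* The codomain is written R^o so that the library's pointwise scaling [*:]
   is available; R^o is R itself. *)
Definition pbfun (R : realType) (n : nat) := {ffun cube n -> R^o}.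

Definition cube_perm (n : nat) (s : 'S_n) (x : cube n) : cube n :=
  [ffun i => x (s i)].

Definition symmetric_fun (R : realType) (n : nat) (g : pbfun R n) : Prop :=
  forall (s : 'S_n) (x : cube n), g (cube_perm s x) = g x.

Definition cweight (n : nat) (x : cube n) : nat := (\sum_(i < n) x i)%N.

Definition sqnorm (R : realType) (n : nat) (w : cube n -> R) (h : pbfun R n) : R :=
  \sum_(x : cube n) w x * h x ^+ 2.

Definition best_symmetric_approx (R : realType) (n : nat) (w : cube n -> R)
    (f g : pbfun R n) : Prop :=
  symmetric_fun g /\
  forall h : pbfun R n, symmetric_fun h -> sqnorm w (f - g) <= sqnorm w (f - h).

(* Only -1 <= s <= n is meaningful; [Negz _] covers the convention at s = -1. *)
Definition level_mean (R : realType) (n : nat) (w : cube n -> R)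
    (f : pbfun R n) (s : int) : R :=
  match s with
  | Posz k => (\sum_(x : cube n | cweight x == k) w x * f x) /
              (\sum_(x : cube n | cweight x == k) w x)
  | Negz _ => 0
  end.

(* k is 1-based.  For k = n+1 the index is out of range of the n sorted
   coordinates, and the default value [true] gives os_{n+1} = 1. *)
Definition os (R : realType) (n k : nat) : pbfun R n :=
  [ffun x : cube n => (nth true (sort <=%O [seq x i | i : 'I_n]) k.-1)%:R].

Definition os_coef (R : realType) (n : nat) (w : cube n -> R)
    (f : pbfun R n) (j : nat) : R :=
  level_mean w f (n%:Z - j%:Z + 1) - level_mean w f (n%:Z - j%:Z).

(* Main.v *)
Require Import Defs.
From HB Require Import structures.
From mathcomp Require Import all_boot all_order all_algebra all_fingroup.
From mathcomp Require Import reals zify ring.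

(** The space of symmetric functions is exactly the space of functions of the
    Hamming weight, because the permutations of the variables act transitively
    on every level [cweight x = s] ([cweight_eq_cube_perm]).  The orthogonal
    projection onto it is therefore the conditional expectation with respect to
    the weight: it replaces [f] by its mean on each level.  This is justified by
    [level_mean_orthogonal] (the residual is orthogonal to every symmetric
    function), which yields the Pythagorean identity [sqnorm_pythagoras];
    minimality and, since all weights are positive, uniqueness follow from it.

    It remains to recognize the expansion in order statistics.  On a point of
    weight [s] the function [os R n j] is the indicator of [n - s < j]
    ([osE]), so only the last [s + 1] terms of the sum survive, and these
    telescope to the mean at level [s] minus the conventional value 0 at level
    -1 ([os_expansionE]). *)

Set Implicit Arguments.
Unset Strict Implicit.
Unset Printing Implicit Defensive.

Import Order.TTheory GRing.Theory Num.Theory.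
Local Open Scope ring_scope.

Lemma count_true_cube (n : nat) (x : cube n) :
  count_mem true [seq x i | i : 'I_n] = cweight x.
Proof.
rewrite count_map /cweight -sumn_count sumnE big_map big_enum /=.
by apply: eq_bigr => i _; rewrite eqb_id.
Qed.

Lemma count_false_cube (n : nat) (x : cube n) :
  count_mem false [seq x i | i : 'I_n] = (n - cweight x)%N.
Proof.
rewrite -count_true_cube -[X in (X - _)%N](card_ord n) -(size_image x).
rewrite -(count_predC (pred1 true)) addKn.
by apply: eq_count => -[].
Qed.

Lemma cweight_le (n : nat) (x : cube n) : (cweight x <= n)%N.
Proof.
rewrite -count_true_cube -[X in (_ <= X)%N](card_ord n) -(size_image x).
exact: count_size.
Qed.

Lemma cweight_cube_perm (n : nat) (s : 'S_n) (x : cube n) :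
  cweight (cube_perm s x) = cweight x.
Proof.
rewrite /cweight [RHS](reindex_inj (@perm_inj _ s)) /=.
by apply: eq_bigr => i _; rewrite ffunE.
Qed.

(** Two boolean words of the same length and weight are rearrangements of each
    other, since the weight determines the multiplicities of both letters. *)
Lemma cweight_eq_cube_perm (n : nat) (x y : cube n) :
  cweight x = cweight y -> exists s : 'S_n, y = cube_perm s x.
Proof.
move=> eq_xy.
have : perm_eq [tuple y i | i < n] [tuple x i | i < n].
  apply/allP => b _ /=.
  by case: b; rewrite ?count_true_cube ?count_false_cube eq_xy.
case/tuple_permP => s def_y; exists s; apply/ffunP => i; rewrite ffunE.
have /(congr1 (fun t => tnth t i)) := val_inj def_y.
by rewrite !tnth_mktuple.
Qed.

Lemma symmetric_fun_cweight (R : realType) (n : nat) (g : pbfun R n)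
    (x y : cube n) :
  symmetric_fun g -> cweight x = cweight y -> g x = g y.
Proof. by move=> sym_g /cweight_eq_cube_perm[s ->]; rewrite sym_g. Qed.

Lemma sort_bool (s : seq bool) :
  sort <=%O s = nseq (count_mem false s) false ++ nseq (count_mem true s) true.
Proof.
apply: (sorted_eq le_trans le_anti (sort_sorted le_total s)).
  elim: (count_mem false s) => [|[|k] IHk] //=.
    by elim: (count_mem true s) => [|[|k] IHk].
  by case: (count_mem true s) IHk.
rewrite perm_sort; apply/allP => b _ /=.
by rewrite count_cat !count_nseq; case: b => /=; rewrite ?mul0n ?mul1n ?addn0.
Qed.

Lemma osE (R : realType) (n k : nat) (x : cube n) :
  os R n k x = (n - cweight x <= k.-1)%N%:R.
Proof.
rewrite ffunE sort_bool count_true_cube count_false_cube nth_cat size_nseq.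
by rewrite !nth_nseq if_same; case: ltnP.
Qed.

Lemma os_expansionE (R : realType) (n : nat) (w : cube n -> R)
    (f : pbfun R n) (x : cube n) :
  (\sum_(1 <= j < n.+2) os_coef w f j *: os R n j) x
  = level_mean w f (cweight x).
Proof.
(* [M] is the sequence of level means shifted by one, so that the convention
   at level -1 becomes its initial value. *)
pose M (i : nat) : R := if i is k.+1 then level_mean w f k%:Z else 0.
have le_xn := cweight_le x.
transitivity (\sum_(0 <= i < n.+1) (M i.+1 - M i) *+ (i <= cweight x)%N).
  rewrite sum_ffunE big_nat_rev big_add1 /=.
  apply: eq_big_nat => i /andP[_ lt_in].
  rewrite ffunE osE -[LHS]/(os_coef _ _ _ * _) mulr_natr.
  have ->: (1 + n.+2 - i.+2 = (n - i).+1)%N by lia.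
  have ->: (n - cweight x <= (n - i).+1.-1)%N = (i <= cweight x)%N by lia.
  congr (_ *+ _); rewrite /os_coef.
  have ->: n%:Z - ((n - i).+1)%:Z + 1 = i%:Z by lia.
  case: i lt_in => [|i] lt_in /=.
    by have ->: n%:Z - ((n - 0).+1)%:Z = Negz 0 by lia.
  by have ->: n%:Z - ((n - i.+1).+1)%:Z = i%:Z by lia.
rewrite (big_cat_nat (n := (cweight x).+1)) //= [X in _ + X]big_nat_cond.
rewrite [X in _ + X]big1 => [|i /andP[/andP[lt_xi _] _]]; last first.
  by rewrite leqNgt lt_xi.
rewrite addr0 (telescope_sumr_eq M) ?subr0 // => i /andP[_].
by rewrite ltnS => ->.
Qed.

(** A symmetric function is constant on each level, and on each level the
    weighted sum of the residual vanishes by definition of the mean. *)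
Lemma level_mean_orthogonal (R : realType) (n : nat) (w : cube n -> R)
    (f h : pbfun R n) :
  (forall x, 0 < w x) -> symmetric_fun h ->
  \sum_x w x * ((f x - level_mean w f (cweight x)) * h x) = 0.
Proof.
move=> w_gt0 sym_h.
rewrite (partition_big (fun x => inord (cweight x) : 'I_n.+1) predT) //=.
apply: big1 => s _.
rewrite (eq_bigl (fun x => cweight x == s)) => [|x]; last first.
  by rewrite -val_eqE /= inordK // ltnS cweight_le.
have [x0 x0_s | level0] := pickP (fun x : cube n => cweight x == s); last first.
  by rewrite big_pred0.
have level_gt0 : 0 < \sum_(x | cweight x == s) w x.
  by rewrite (bigD1 x0) //= ltr_pwDl // sumr_ge0 // => x _; apply: ltW.
transitivity (h x0 * \sum_(x | cweight x == s)
                       (w x * f x - w x * level_mean w f s)).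
  rewrite mulr_sumr; apply: eq_bigr => x /eqP x_s.
  rewrite -(symmetric_fun_cweight sym_h (x := x)) ?x_s ?(eqP x0_s) //.
  by rewrite mulrA mulrBr mulrC.
rewrite sumrB -mulr_suml /level_mean mulrC [X in _ - X]mulrC.
by rewrite divfK ?gt_eqF // subrr mul0r.
Qed.

Lemma sqnorm_ge0 (R : realType) (n : nat) (w : cube n -> R) (h : pbfun R n) :
  (forall x, 0 < w x) -> 0 <= sqnorm w h.
Proof.
by move=> w_gt0; apply: sumr_ge0 => x _; rewrite mulr_ge0 ?sqr_ge0 ?ltW.
Qed.

Lemma sqnorm_le0 (R : realType) (n : nat) (w : cube n -> R) (h : pbfun R n) :
  (forall x, 0 < w x) -> sqnorm w h <= 0 -> h = 0.
Proof.
move=> w_gt0 h_le0; apply/ffunP => x; rewrite [RHS]ffunE.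
have term_ge0 y : true -> 0 <= w y * h y ^+ 2.
  by move=> _; rewrite mulr_ge0 ?sqr_ge0 ?ltW.
have /eqP h_eq0 : sqnorm w h == 0 by rewrite eq_le h_le0 sqnorm_ge0.
have /eqP := psumr_eq0P term_ge0 h_eq0 (i := x) isT.
by rewrite mulf_eq0 gt_eqF //= sqrf_eq0 => /eqP.
Qed.

Lemma sqnorm_pythagoras (R : realType) (n : nat) (w : cube n -> R)
    (f g h : pbfun R n) :
  (forall x, 0 < w x) -> (forall x, g x = level_mean w f (cweight x)) ->
  symmetric_fun h ->
  sqnorm w (f - h) = sqnorm w (f - g) + sqnorm w (g - h).
Proof.
move=> w_gt0 gE sym_h.
have sym_gh : symmetric_fun (g - h).
  by move=> s x; rewrite !ffunE !gE cweight_cube_perm sym_h.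
rewrite -[RHS]addr0 -[X in _ = _ + X](mul0rn _ 2).
rewrite -(level_mean_orthogonal f w_gt0 sym_gh) -sumrMnl -!big_split.
have sqrE (c a b d : R) :
    c * (a - d) ^+ 2
    = c * (a - b) ^+ 2 + c * (b - d) ^+ 2 + c * ((a - b) * (b - d)) *+ 2.
  by ring.
by apply: eq_bigr => x _; rewrite -gE !ffunE; apply: sqrE.
Qed.

Theorem theorem3 (R : realType) (n : nat) (w : cube n -> R) (f : pbfun R n)
    (n_ge1 : (1 <= n)%N)
    (w_gt0 : forall x : cube n, 0 < w x)
    (w_sum1 : \sum_(x : cube n) w x = 1) :
  unique (best_symmetric_approx w f)
    (\sum_(1 <= j < n.+2) os_coef w f j *: os R n j).
Proof.
have gE := os_expansionE w f.
move: (\sum_(1 <= j < n.+2) _) gE => g gE.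
have sym_g : symmetric_fun g by move=> s x; rewrite !gE cweight_cube_perm.
split=> [|h [sym_h /(_ g sym_g)]].
  split=> // h sym_h.
  by rewrite (sqnorm_pythagoras w_gt0 gE sym_h) lerDl sqnorm_ge0.
rewrite (sqnorm_pythagoras w_gt0 gE sym_h) gerDl => /(sqnorm_le0 w_gt0) gh0.
exact: subr0_eq gh0.
Qed.
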